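(* For every positive integer $n$, consider the transducer $\mathcal{T}_n$ defined below. (a) (Standard construction.) Let $\mathcal{T}'_n$ be the trimmed result of the specialized determinization of $\mathcal{T}_n$, and let $\mathcal{A}_L^{std}$ and $\mathcal{A}_R^{std}$ be the accessible subset-construction determinizations of the underlying automaton of $\mathcal{T}'_n$ and of the reversed underlying automaton of $\mathcal{T}'_n$, respectively. Then $\mathcal{A}_L^{std}$ and $\mathcal{A}_R^{std}$ together have at least $(n!+2)+(2^n+n)$ states. (b) (New construction.) Let $\mathcal{A}_L^{new}$ and $\mathcal{A}_R^{new}$ be the accessible subset-construction determinizations of the underlying automaton of $\mathcal{T}_n$ and of the reversed underlying automaton of $\mathcal{T}_n$, respectively. Then $\mathcal{A}_L^{new}$ and $\mathcal{A}_R^{new}$ together have exactly $3+(2^n+n)$ states.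
   Context: Let $\Sigma_n=\{a_1,\dots,a_n\}$ and let the output monoid be the free monoid $\{1\}^*$. $\mathcal{T}_n=\langle\Sigma_n^*\times\{1\}^*,Q,\{s\},\{f\},\Delta_n\rangle$ with $Q=\{s,q_1,\dots,q_n,f\}$, $Q_n=\{q_1,\dots,q_n\}$, and $\Delta_n=\Delta_{s,n}\cup\Delta_{Q_n}\cup\Delta_{f,n}$ where: $\Delta_{s,n}=\{\langle s,\langle a_j,1^{i-1}\rangle,q_i\rangle:1\le i,j\le n\}$; $\Delta_{Q_n}$ consists, for all $1\le i,j\le n$, of the transition $\langle q_i,\langle a_j,1^n\rangle,q_i\rangle$ if $i\notin\{1,j\}$, $\langle q_1,\langle a_j,1^{n+j-1}\rangle,q_j\rangle$ if $i=1$, and $\langle q_j,\langle a_j,1^{n-j+1}\rangle,q_1\rangle$ if $i=j\neq1$; $\Delta_{f,n}=\{\langle q_i,\langle a_j,1^{2n-i+1}\rangle,f\rangle:1\le j\le i\le n\}$. The underlying automaton of a transducer $\langle\Sigma^*\times\mathcal{M},Q,I,F,\Delta\rangle$ is the nondeterministic automaton over $\Sigma$ with states $Q$, initial states $I$, final states $F$ and transitions $\langle p,a,q\rangle$ for each $\langle p,\langle a,m\rangle,q\rangle\in\Delta$; its reversal swaps initial and final states and reverses all transitions. The accessible subset-construction determinization of an automaton with initial set $I$ has as states exactly the subsets reachable from $I$ via $\delta(P,a)=\{q:\exists p\in P,\ \langle p,a,q\rangle\}$. Specialized determinization: for a transducer with a single initial state $i$ over $\Sigma\times\Omega^*$ (here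 $\Omega=\{1\}$, with strict lexicographic order $\prec$ on $\Omega^*$, i.e. $1^k\prec1^l$ iff $k<l$), states are pairs $\langle p,N\rangle\in Q\times2^Q$, generated inductively starting from $\langle i,\emptyset\rangle$: for a generated $\langle p,N\rangle$ and $\langle p,\langle a,v\rangle,p'\rangle\in\Delta$ put $N'=\{q':\exists q\in N,\exists v'\,\langle q,\langle a,v'\rangle,q'\rangle\in\Delta\}\cup\{q:\exists v'\prec v,\ \langle p,\langle a,v'\rangle,q\rangle\in\Delta\}$; if $p'\notin N'$, the state $\langle p',N'\rangle$ and the transition $\langle\langle p,N\rangle,\langle a,v\rangle,\langle p',N'\rangle\rangle$ are added. Final states are $\{\langle f,N\rangle: f\in F,\ N\cap F=\emptyset\}$. Trimming keeps only states that are accessible (reachable from the initial state) and co-accessible (can reach a final state). *)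

(* Defs.v *)
From mathcomp Require Import all_boot.
Set Implicit Arguments. Unset Strict Implicit. Unset Printing Implicit Defensive.

(* an NFA over alphabet A: state finType Q, initial set I, transition
   relation t p a q.  (Final states play no role in the subset construction
   count.) *)
Definition dstep (Q A : finType) (t : Q -> A -> Q -> bool) (P : {set Q}) (a : A)
  : {set Q} := [set q | [exists p in P, t p a q]].

Definition subset_states (Q A : finType) (t : Q -> A -> Q -> bool) (I : {set Q})
  : {set {set Q}} :=
  [set P | connect (fun P P' : {set Q} => [exists a, P' == dstep t P a]) I P].

Definition rev_trans (Q A : finType) (t : Q -> A -> Q -> bool) : Q -> A -> Q -> bool :=
  fun p a q => t q a p.

(* Transducers over Sigma^* x {1}^* ; the output 1^k is encoded by k : nat *)

Definition tr_src (Q A : finType) (d : Q * A * nat * Q) : Q := d.1.1.1.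
Definition tr_lbl (Q A : finType) (d : Q * A * nat * Q) : A := d.1.1.2.
Definition tr_out (Q A : finType) (d : Q * A * nat * Q) : nat := d.1.2.
Definition tr_tgt (Q A : finType) (d : Q * A * nat * Q) : Q := d.2.

Definition under_trans (Q A : finType) (delta : seq (Q * A * nat * Q)) : Q -> A -> Q -> bool :=
  fun p a q => has (fun d => [&& tr_src d == p, tr_lbl d == a & tr_tgt d == q]) delta.

Section SpecDet.
Variables (Q A : finType) (i : Q) (F : {set Q}) (delta : seq (Q * A * nat * Q)).

(* N' for the step from <p,N> along a transition labelled <a,1^v>;
   the strict order 1^k < 1^l iff k < l *)
Definition sd_newN (p : Q) (N : {set Q}) (a : A) (v : nat) : {set Q} :=
  [set q' | [exists q in N, has (fun d => [&& tr_src d == q, tr_lbl d == a & tr_tgt d == q']) delta]]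
  :|: [set q | has (fun d => [&& tr_src d == p, tr_lbl d == a, tr_out d < v & tr_tgt d == q]) delta].

Definition sd_step (x : Q * {set Q}) (a : A) (y : Q * {set Q}) : bool :=
  has (fun d => [&& tr_src d == x.1, tr_lbl d == a,
                    y == (tr_tgt d, sd_newN x.1 x.2 a (tr_out d))
                  & tr_tgt d \notin sd_newN x.1 x.2 a (tr_out d)]) delta.

Definition sd_init : Q * {set Q} := (i, set0).

Definition sd_generated (x : Q * {set Q}) : bool :=
  connect (fun x y => [exists a, sd_step x a y]) sd_init x.

Definition sd_trans (x : Q * {set Q}) (a : A) (y : Q * {set Q}) : bool :=
  sd_generated x && sd_step x a y.

Definition sd_final (x : Q * {set Q}) : bool :=
  sd_generated x && (x.1 \in F) && (x.2 :&: F == set0).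

Definition sd_coaccessible (x : Q * {set Q}) : bool :=
  [exists y, connect (fun x y => [exists a, sd_trans x a y]) x y && sd_final y].

Definition sd_kept (x : Q * {set Q}) : bool :=
  sd_generated x && sd_coaccessible x.

Definition trim_trans (x : Q * {set Q}) (a : A) (y : Q * {set Q}) : bool :=
  [&& sd_kept x, sd_kept y & sd_trans x a y].
Definition trim_init : {set Q * {set Q}} := [set x | sd_kept x && (x == sd_init)].
Definition trim_final : {set Q * {set Q}} := [set x | sd_kept x && sd_final x].

End SpecDet.

(* States 'I_n.+2 : 0 = s, k = q_k (1 <= k <= n), n+1 = f.             *)
(* Alphabet 'I_n : the letter j : 'I_n stands for a_(j+1).             *)

Definition Tst_s (n : nat) : 'I_n.+2 := inord 0.
Definition Tst_q (n : nat) (k : nat) : 'I_n.+2 := inord k.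
Definition Tst_f (n : nat) : 'I_n.+2 := inord n.+1.

Definition Tdelta_s (n : nat) : seq ('I_n.+2 * 'I_n * nat * 'I_n.+2) :=
  [seq (Tst_s n, j, i - 1, Tst_q n i) | i <- iota 1 n, j <- enum 'I_n].

Definition TQ_trans (n i : nat) (j' : 'I_n) : 'I_n.+2 * 'I_n * nat * 'I_n.+2 :=
  let j := (val j').+1 in
  if (i != 1) && (i != j) then (Tst_q n i, j', n, Tst_q n i)
  else if i == 1 then (Tst_q n 1, j', n + j - 1, Tst_q n j)
  else (Tst_q n j, j', n - j + 1, Tst_q n 1).

Definition Tdelta_Q (n : nat) : seq ('I_n.+2 * 'I_n * nat * 'I_n.+2) :=
  [seq TQ_trans i j | i <- iota 1 n, j <- enum 'I_n].

Definition Tdelta_f (n : nat) : seq ('I_n.+2 * 'I_n * nat * 'I_n.+2) :=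
  [seq (Tst_q n i, j, 2 * n - i + 1, Tst_f n) | i <- iota 1 n, j <- [seq j <- enum 'I_n | (val j).+1 <= i]].

Definition Tdelta (n : nat) : seq ('I_n.+2 * 'I_n * nat * 'I_n.+2) :=
  Tdelta_s n ++ Tdelta_Q n ++ Tdelta_f n.

Definition Tinit (n : nat) : {set 'I_n.+2} := [set Tst_s n].
Definition Tfinal (n : nat) : {set 'I_n.+2} := [set Tst_f n].

Definition AL_std (n : nat) : {set {set 'I_n.+2 * {set 'I_n.+2}}} :=
  subset_states (trim_trans (Tst_s n) (Tfinal n) (Tdelta n))
                (trim_init (Tst_s n) (Tfinal n) (Tdelta n)).
Definition AR_std (n : nat) : {set {set 'I_n.+2 * {set 'I_n.+2}}} :=
  subset_states (rev_trans (trim_trans (Tst_s n) (Tfinal n) (Tdelta n)))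
                (trim_final (Tst_s n) (Tfinal n) (Tdelta n)).

Definition AL_new (n : nat) : {set {set 'I_n.+2}} :=
  subset_states (under_trans (Tdelta n)) (Tinit n).
Definition AR_new (n : nat) : {set {set 'I_n.+2}} :=
  subset_states (rev_trans (under_trans (Tdelta n))) (Tfinal n).

(* Main.v *)
(** For a set [P] of states let [survivors P] be the generated pairs [(p, N)]
    with [p] in [P] and [N] disjoint from [P].  In any specialized
    determinization, [survivors] commutes with reading a letter backwards, so
    it maps the reversed subset construction of the original automaton into
    that of the trimmed one.  For [T_n] this map is injective, because every
    [(q_i, set0)] is generated; hence [AR_std] is at least as large as
    [AR_new], whose members are [{f}], the upper sets [{q_a, ..., q_n}] and the
    sets [{s} U X] with [X] a nonempty subset of [{q_1, ..., q_n}].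

    Reading [a_j] swaps [q_1] and [q_j].  After the first letter, a set [S]
    reachable in [AL_std] thus determines a permutation, which sends [i] to the
    number of [q_k] in [N] for any [(q_i, N)] in [S].  The transpositions
    [(1 j)] generate the symmetric group, so all [n!] permutations occur.  The
    set reached by a single letter is counted separately: it shares the
    identity permutation with the set reached by [a_1 a_1], but contains no
    pair with first component [f]. *)

Require Import Defs.
From mathcomp Require Import all_boot all_fingroup.

Set Implicit Arguments. Unset Strict Implicit. Unset Printing Implicit Defensive.

(** * The subset construction: membership and induction *)

Lemma mem_dstep (Q A : finType) (t : Q -> A -> Q -> bool) (P : {set Q}) a q :
  (q \in dstep t P a) = [exists p in P, t p a q].
Proof. by rewrite inE. Qed.

Section SubsetStates.
Variables (Q A : finType) (t : Q -> A -> Q -> bool) (I : {set Q}).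

Lemma subset_states_init : I \in subset_states t I.
Proof. by rewrite inE connect0. Qed.

Lemma subset_states_step P a :
  P \in subset_states t I -> dstep t P a \in subset_states t I.
Proof.
rewrite !inE => /connect_trans; apply; apply: connect1.
by apply/existsP; exists a.
Qed.

Lemma subset_states_ind (K : {set Q} -> Prop) :
  K I -> (forall P a, K P -> K (dstep t P a)) ->
  forall P, P \in subset_states t I -> K P.
Proof.
move=> KI Kstep P; rewrite inE => /connectP [p pth ->].
elim: p I KI pth => //= P' p IHp P0 KP0 /andP [/existsP [a /eqP ->]].
by apply: IHp; apply: Kstep.
Qed.

End SubsetStates.

(** * Specialized determinization of an arbitrary transducer, read backwards *)

Section SpecDetTheory.
Variables (Q A : finType) (i : Q) (F : {set Q}) (delta : seq (Q * A * nat * Q)).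
Implicit Types (P N : {set Q}) (x y : Q * {set Q}).

Local Notation trans := (under_trans delta).
Local Notation generated := (sd_generated i delta).
Local Notation coacc := (sd_coaccessible i F delta).

Lemma under_transP p a q :
  reflect (exists v, (p, a, v, q) \in delta) (trans p a q).
Proof.
apply: (iffP hasP) => [[[[[p' a'] v] q'] d_in] | [v d_in]].
  by rewrite /tr_src /tr_lbl /tr_tgt /= => /and3P [/eqP <- /eqP <- /eqP <-]; exists v.
by exists (p, a, v, q); rewrite // /tr_src /tr_lbl /tr_tgt /= !eqxx.
Qed.

Lemma sd_newNP p N a v q :
  reflect ((exists2 p', p' \in N & trans p' a q) \/
           (exists2 v', v' < v & (p, a, v', q) \in delta))
          (q \in sd_newN delta p N a v).
Proof.
rewrite in_setU !inE; apply: (iffP orP) => -[].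
- by case/exists_inP=> p' Np' tp'; left; exists p'.
- case/hasP=> [[[[p' a'] v'] q'] d_in].
  rewrite /tr_src /tr_lbl /tr_out /tr_tgt /=.
  by case/and4P=> /eqP <- /eqP <- lt_v /eqP <-; right; exists v'.
- by case=> p' Np' tp'; left; apply/exists_inP; exists p'.
- case=> v' lt_v d_in; right; apply/hasP; exists (p, a, v', q) => //.
  by rewrite /tr_src /tr_lbl /tr_out /tr_tgt /= !eqxx lt_v.
Qed.

Lemma sd_stepP p N a y :
  reflect (exists v q, [/\ (p, a, v, q) \in delta, y = (q, sd_newN delta p N a v)
                         & q \notin sd_newN delta p N a v])
          (sd_step delta (p, N) a y).
Proof.
apply: (iffP hasP) => [[[[[p' a'] v] q] d_in] | [v [q [d_in -> qN]]]].
  rewrite /tr_src /tr_lbl /tr_out /tr_tgt /=.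
  by case/and4P=> /eqP <- /eqP <- /eqP -> qN; exists v, q.
exists (p, a, v, q) => //.
by rewrite /tr_src /tr_lbl /tr_out /tr_tgt /= !eqxx.
Qed.

Lemma sd_generated_init : generated (sd_init i).
Proof. exact: connect0. Qed.

Lemma sd_generated_step x a y : generated x -> sd_step delta x a y -> generated y.
Proof.
move=> gx xy; apply: connect_trans gx (connect1 _).
by apply/existsP; exists a.
Qed.

Lemma sd_generated_ind (K : Q * {set Q} -> Prop) :
  K (sd_init i) -> (forall x a y, K x -> sd_step delta x a y -> K y) ->
  forall x, generated x -> K x.
Proof.
move=> Ki Kstep x /connectP [p pth ->].
elim: p (sd_init i) Ki pth => //= y p IHp x0 Kx0 /andP [/existsP [a x0y]].
by apply: IHp; apply: Kstep x0y.
Qed.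

Lemma sd_generated_notin x : generated x -> x.1 \notin x.2.
Proof.
move: x; apply: (sd_generated_ind (K := fun x => x.1 \notin x.2)).
  by rewrite inE.
by case=> p N a y _ /sd_stepP [v [q [_ -> ]]].
Qed.

Lemma sd_coaccessible_step x a y :
  generated x -> sd_step delta x a y -> coacc y -> coacc x.
Proof.
move=> gx xy /existsP [z /andP [yz fz]]; apply/existsP; exists z.
rewrite fz andbT; apply: connect_trans yz; apply: connect1.
by apply/existsP; exists a; rewrite /sd_trans gx.
Qed.

Definition survivors P : {set Q * {set Q}} :=
  [set x | [&& generated x, x.1 \in P & [disjoint x.2 & P]]].

(* Among the transitions from [p] into [P], one of least output is not killed
   by the second component of its target. *)
Lemma survivors_step P p N a :
  (p \in dstep (Defs.rev_trans trans) P a) && [disjoint N & dstep (Defs.rev_trans trans) P a] =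
  [exists y, [&& sd_step delta (p, N) a y, y.1 \in P & [disjoint y.2 & P]]].
Proof.
apply/andP/existsP => [[] | [[q0 N0] /and3P [/sd_stepP [v [q [d_in [-> ->] _]]] /= Pq dNP]]].
- rewrite mem_dstep => /exists_inP [q0 Pq0 /under_transP [v0 d0_in]] dNP.
  have ex : exists v, has (fun q => (p, a, v, q) \in delta) (enum P).
    by exists v0; apply/hasP; exists q0; rewrite ?mem_enum.
  case: (ex_minnP ex) => v /hasP [q]; rewrite mem_enum => Pq d_in v_min.
  have dis : [disjoint sd_newN delta p N a v & P].
    apply/pred0P => r /=; apply/negP => /andP [/sd_newNP [] [] z].
      move=> Nz tz Pr; have /pred0P/(_ z)/negP[] := dNP.
      by rewrite /= Nz mem_dstep; apply/exists_inP; exists r.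
    move=> lt_zv dr_in Pr; have := v_min z; rewrite leqNgt lt_zv => /(_ _)/negP [] //.
    by apply/hasP; exists r; rewrite ?mem_enum.
  exists (q, sd_newN delta p N a v); rewrite Pq dis !andbT.
  apply/sd_stepP; exists v, q; split=> //.
  by have /pred0P/(_ q)/= := dis; rewrite Pq andbT => ->.
- split; first by rewrite mem_dstep; apply/exists_inP; exists q => //; apply/under_transP; exists v.
  apply/pred0P => r /=; apply/negP => /andP [Nr]; rewrite mem_dstep => /exists_inP [r' Pr' tr].
  have /pred0P/(_ r')/negP[] := dNP; rewrite /= Pr' andbT.
  by apply/sd_newNP; left; exists r.
Qed.

(** Disjointness from [F] is the finality condition itself, and a final pair is co-accessible by the
    empty path, so trimming keeps it. *)
Lemma survivors_final : survivors F = trim_final i F delta.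
Proof.
apply/setP=> x; rewrite !inE /sd_kept /sd_final -andbA -setI_eq0.
case: (boolP (generated x)) => //= gx.
case: (boolP (_ && _)) => [/andP [Fx xF] | _]; last by rewrite andbF.
rewrite andbT; apply/esym/existsP; exists x.
by rewrite connect0 /sd_final gx Fx xF.
Qed.

(** A survivor of the predecessor set has a step to a survivor of [P], from which a final pair can
    be reached. *)
Lemma survivors_coacc_dstep P a :
  {in survivors P, forall x, coacc x} ->
  {in survivors (dstep (Defs.rev_trans trans) P a), forall x, coacc x}.
Proof.
move=> coP [p N]; rewrite inE => /andP [gx].
rewrite survivors_step => /existsP [y /andP [xy /andP [Py dy]]].
apply: (sd_coaccessible_step gx xy); apply: coP.
by rewrite inE (sd_generated_step gx xy) Py.
Qed.

(** Co-accessibility of the survivors ensures that trimming removes none of them; what is left is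
    [survivors_step]. *)
Lemma dstep_survivors P a :
  {in survivors P, forall x, coacc x} ->
  dstep (Defs.rev_trans (trim_trans i F delta)) (survivors P) a =
  survivors (dstep (Defs.rev_trans trans) P a).
Proof.
move=> coP; apply/setP=> -[p N]; rewrite mem_dstep.
apply/exists_inP/idP => [[y] | sx].
- rewrite inE => /and3P [gy Py dy] /and3P [_ _ /andP [gx xy]].
  rewrite inE gx survivors_step; apply/existsP; exists y.
  by rewrite xy Py.
have co_x := survivors_coacc_dstep coP sx.
move: sx; rewrite inE => /andP [gx].
rewrite survivors_step => /existsP [y /and3P [xy Py dy]].
have gy := sd_generated_step gx xy.
have sy : y \in survivors P by rewrite inE gy Py.
by exists y; rewrite // /Defs.rev_trans /trim_trans /sd_trans /sd_kept gx gy co_x xy coP.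
Qed.

Local Notation AR := (subset_states (Defs.rev_trans trans) F).

Lemma survivors_coacc P : P \in AR -> {in survivors P, forall x, coacc x}.
Proof.
move: P; apply: subset_states_ind => [x | P a]; last exact: survivors_coacc_dstep.
by rewrite survivors_final inE => /andP [/andP []].
Qed.

Lemma survivors_subset_states P : P \in AR ->
  survivors P \in subset_states (Defs.rev_trans (trim_trans i F delta)) (trim_final i F delta).
Proof.
(* The induction also carries membership of [P], since commutation with a letter requires its
   survivors to be co-accessible. *)
suff K : P \in AR -> P \in AR /\
    survivors P \in subset_states (Defs.rev_trans (trim_trans i F delta)) (trim_final i F delta).
  by case/K.
move: P; apply: subset_states_ind => [|P a [ARP sP]].
  by rewrite survivors_final !subset_states_init.
rewrite -(dstep_survivors _ (survivors_coacc ARP)).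
by split; apply: subset_states_step.
Qed.

End SpecDetTheory.

(** * Permutations: star transpositions and sets of equal size *)

Lemma star_tperm_ind m (K : 'S_m.+1 -> Prop) :
  K 1%g -> (forall a s, K s -> K (tperm ord0 a * s)%g) -> forall s, K s.
Proof.
move=> K1 KM s.
have : s \in <<[set tperm ord0 y | y : 'I_m.+1]>>%g by rewrite gen_tperm inE.
case/gen_prodgP=> k [c c_in ->]; elim: k c c_in => [|k IHk] c c_in.
  by rewrite big_ord0.
rewrite big_ord_recl; case/imsetP: (c_in ord0) => y _ ->.
by apply: KM; apply: IHk => j.
Qed.

(** List each set followed by its complement, and send every element of the first list to the
    element at the same position in the second. *)
Lemma exists_perm_imset (T : finType) (A B : {set T}) :
  #|A| = #|B| -> exists s : {perm T}, s @: A = B.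
Proof.
pose lst (C : {set T}) := enum C ++ enum (~: C).
have lstE C x : x \in lst C by rewrite mem_cat !mem_enum inE orbN.
have lst_uniq C : uniq (lst C).
  rewrite cat_uniq !enum_uniq andbT; apply/hasPn => x /=.
  by rewrite !mem_enum inE.
have lst_size C : size (lst C) = #|T|.
  by rewrite size_cat -!cardE cardsC.
move=> eqAB; pose g x := nth x (lst B) (index x (lst A)).
have ltB x : index x (lst A) < size (lst B) by rewrite lst_size -(lst_size A) index_mem.
have g_inj : injective g.
  move=> x y; rewrite /g (set_nth_default y) // => /eqP.
  by rewrite nth_uniq // => /eqP/(congr1 (nth x (lst A))); rewrite (set_nth_default y (s := lst A)) ?index_mem // !nth_index.
exists (perm g_inj); apply/eqP; rewrite eqEcard card_imset ?eqAB ?leqnn ?andbT; last exact: perm_inj.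
apply/subsetP=> _ /imsetP [x Ax ->]; rewrite permE /g.
(* An element of [A] has an index below [#|A| = #|B|], so its image is taken from [enum B]. *)
have lt : index x (enum A) < #|A| by rewrite cardE index_mem mem_enum.
by rewrite nth_cat index_cat mem_enum Ax -cardE -eqAB lt -mem_enum mem_nth // -cardE -eqAB.
Qed.

(** * States and transitions of the transducer *)

Section Transducer.
Variable m : nat.
Local Notation n := m.+1.
Local Notation St := 'I_n.+2.
Implicit Types (i j k a : 'I_n) (p : St) (X Y : {set 'I_n}) (N : {set St}).

Local Notation s := (Tst_s n).
Local Notation f := (Tst_f n).
(** Indices start at 0: [q i] is the state $q_{i+1}$, and $q_1$ is [q ord0]. *)
Definition q i : St := Tst_q n i.+1.
(** The transposition of indices by which the letter [a] acts on $Q_n$. *)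
Definition tau a i : 'I_n := tperm ord0 a i.

Local Notation delta := (Tdelta n).
Local Notation trans := (under_trans delta).

Lemma val_q i : q i = i.+1 :> nat.
Proof. by rewrite /q /Tst_q inordK // !ltnS ltnW. Qed.

Lemma val_s : s = 0 :> nat. Proof. by rewrite /Tst_s inordK. Qed.
Lemma val_f : f = n.+1 :> nat. Proof. by rewrite /Tst_f inordK. Qed.

Lemma q_inj : injective q.
Proof. by move=> i j /(congr1 (@nat_of_ord _)); rewrite !val_q => -[/val_inj]. Qed.

Lemma q_eq_s i : (q i == s) = false.
Proof. by rewrite -val_eqE /= val_q val_s. Qed.

Lemma q_eq_f i : (q i == f) = false.
Proof. by rewrite -val_eqE /= val_q val_f eqSS ltn_eqF. Qed.

Lemma s_eq_f : (s == f) = false.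
Proof. by rewrite -val_eqE /= val_s val_f. Qed.

Definition stE := (q_eq_s, q_eq_f, s_eq_f, (eq_sym s), (eq_sym f), inj_eq q_inj).

Variant state_spec : St -> Type :=
  | StateS : state_spec s
  | StateQ i : state_spec (q i)
  | StateF : state_spec f.

Lemma stateP p : state_spec p.
Proof.
have [p0 | p_gt0] := posnP p.
  have -> : p = s by apply: val_inj; rewrite /= p0 val_s.
  exact: StateS.
have [p_lt | p_ge] := ltnP p.-1 n.
  have -> : p = q (Ordinal p_lt) by apply: val_inj; rewrite /= val_q prednK.
  exact: StateQ.
have -> : p = f; last exact: StateF.
apply: val_inj; rewrite /= val_f; apply/eqP; rewrite eqn_leq -ltnS ltn_ord.
by rewrite -(prednK p_gt0) ltnS.
Qed.

Lemma tauK a : involutive (tau a).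
Proof. by move=> i; rewrite /tau tpermK. Qed.

Definition outQ i a := tr_out (TQ_trans i.+1 a).

Lemma TQ_transE i a : TQ_trans i.+1 a = (q i, a, outQ i a, q (tau a i)).
Proof.
rewrite /outQ /TQ_trans /tau /q /tr_out /= !eqSS.
have [-> | i0] := eqVneq i ord0; first by rewrite tpermL.
have -> : (i == 0 :> nat) = false by apply: negbTE; rewrite -(inj_eq val_inj) in i0.
rewrite /= -[i == a :> nat]/(i == a); have [-> | ia] := eqVneq i a; first by rewrite tpermR.
by rewrite tpermD // eq_sym.
Qed.

Lemma mem_iota1 (k : nat) : reflect (exists i : 'I_n, k = i.+1) (k \in iota 1 n).
Proof.
rewrite mem_iota; apply: (iffP andP) => [[k_gt0 k_lt] | [i ->]]; last by split; rewrite // add1n ltnS.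
have lt : k.-1 < n by rewrite -ltnS prednK.
by exists (Ordinal lt); rewrite /= prednK.
Qed.

(** The three families of transitions with indices counted from 0: the output $1^{i-1}$ from [s]
    becomes [i], and $j \le i$ becomes [a <= i]. *)
Variant Tdelta_spec : St * 'I_n * nat * St -> Prop :=
  | DeltaS i a : Tdelta_spec (s, a, nat_of_ord i, q i)
  | DeltaQ i a : Tdelta_spec (q i, a, outQ i a, q (tau a i))
  | DeltaF i a of a <= i : Tdelta_spec (q i, a, 2 * n - i.+1 + 1, f).

Lemma mem_Tdelta d : reflect (Tdelta_spec d) (d \in delta).
Proof.
rewrite /Tdelta mem_cat (mem_cat _ (Tdelta_Q n)); apply: (iffP or3P) => [[] | [i a | i a | i a le_ai]].
- by case/allpairsPdep=> k [a [/mem_iota1 [i ->] _ ->]]; rewrite subn1; constructor.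
- case/allpairsPdep=> k [a [/mem_iota1 [i ->] _ ->]]; rewrite TQ_transE; constructor.
- case/allpairsPdep=> k [a [/mem_iota1 [i ->]]].
  by rewrite mem_filter => /andP [le_ai _] ->; constructor.
- apply: Or31; apply/allpairsPdep; exists i.+1, a.
  by rewrite mem_enum subn1; split=> //; apply/mem_iota1; exists i.
- apply: Or32; apply/allpairsPdep; exists i.+1, a.
  by rewrite mem_enum TQ_transE; split=> //; apply/mem_iota1; exists i.
- apply: Or33; apply/allpairsPdep; exists i.+1, a.
  split=> //; first by apply/mem_iota1; exists i.
  by rewrite mem_filter mem_enum andbT.
Qed.

(** From [s] the output names the target; from [q i] a letter has one transition into $Q_n$ and at
    most one into [f]. Hence a competitor with smaller output always has a different target. *)
Lemma Tdelta_out_uniq p a v w r : (p, a, v, r) \in delta -> (p, a, w, r) \in delta -> v = w.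
Proof.
have spec_out d e : Tdelta_spec d -> Tdelta_spec e ->
    d.1.1 = e.1.1 -> d.2 = e.2 -> d.1.2 = e.1.2.
  case=> [i b|i b|i b _] [j c|j c|j c _] //= [] /eqP; rewrite ?stE // => /eqP.
  - by move=> _ /q_inj ->.
  1-4: by move=> -> eb /eqP; rewrite ?stE ?eb.
by move=> /mem_Tdelta dv /mem_Tdelta dw; apply: (spec_out _ _ dv dw).
Qed.

Lemma trans_s a p : trans s a p = [exists i, p == q i].
Proof.
apply/under_transP/existsP => [[v] | [i /eqP ->]]; last first.
  by exists (nat_of_ord i); apply/mem_Tdelta; constructor.
move/mem_Tdelta; case E: _ / => [i b|i b|i b _]; case: E => /eqP; rewrite ?stE // => _ _ ->.
by exists i.
Qed.

Lemma trans_q i a p : trans (q i) a p = (p == q (tau a i)) || (a <= i) && (p == f).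
Proof.
apply/under_transP/orP => [[v] | [/eqP -> | /andP [le_ai /eqP ->]]].
- move/mem_Tdelta; case E: _ / => [j b|j b|j b le_bj]; case: E => /eqP; rewrite ?stE //.
    by move=> /eqP -> -> _ ->; left.
  by move=> /eqP -> -> _ ->; right; rewrite le_bj eqxx.
- by exists (outQ i a); apply/mem_Tdelta; constructor.
- by exists (2 * n - i.+1 + 1); apply/mem_Tdelta; constructor.
Qed.

Lemma trans_f a p : trans f a p = false.
Proof.
apply/under_transP => -[v] /mem_Tdelta; case E: _ / => [j b|j b|j b _].
all: by case: E => /eqP; rewrite !stE.
Qed.

(** * Reversed subset construction of the original transducer *)

Local Notation pre P a := (dstep (Defs.rev_trans trans) P a).
Local Notation upper a := [set i : 'I_n | nat_of_ord a <= i].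

Definition sq X : {set St} := s |: q @: X.

Lemma mem_sq X p : (p \in sq X) = (p == s) || (p \in q @: X).
Proof. by rewrite in_setU1. Qed.

Lemma s_notin_q X : (s \in q @: X) = false.
Proof. by apply/imsetP => -[i _ /eqP]; rewrite !stE. Qed.

Lemma f_notin_q X : (f \in q @: X) = false.
Proof. by apply/imsetP => -[i _ /eqP]; rewrite !stE. Qed.

Lemma mem_pre_s P a : (s \in pre P a) = [exists i, q i \in P].
Proof.
rewrite mem_dstep; apply/exists_inP/existsP => [[p Pp] | [i Pi]].
  by rewrite /Defs.rev_trans trans_s => /existsP [i /eqP def_p]; exists i; rewrite -def_p.
by exists (q i) => //; rewrite /Defs.rev_trans trans_s; apply/existsP; exists i.
Qed.

Lemma mem_pre_q P a i : (q i \in pre P a) = (q (tau a i) \in P) || (a <= i) && (f \in P).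
Proof.
rewrite mem_dstep; apply/exists_inP/orP => [[p Pp] | [Pi | /andP [le_ai Pf]]].
- rewrite /Defs.rev_trans trans_q => /orP [/eqP <- | /andP [-> /eqP <-]]; first by left.
  by right.
- by exists (q (tau a i)); rewrite // /Defs.rev_trans trans_q eqxx.
- by exists f; rewrite // /Defs.rev_trans trans_q le_ai eqxx orbT.
Qed.

Lemma mem_pre_f P a : (f \in pre P a) = false.
Proof. by rewrite mem_dstep; apply/exists_inP => -[p _]; rewrite /Defs.rev_trans trans_f. Qed.

Lemma mem_tau a X i : (i \in tau a @: X) = (tau a i \in X).
Proof.
apply/imsetP/idP => [[j Xj ->] | Xi]; first by rewrite tauK.
by exists (tau a i); rewrite ?tauK.
Qed.

Lemma pre_final a : pre [set f] a = q @: upper a.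
Proof.
apply/setP=> p; case: (stateP p) => [|i|].
- rewrite mem_pre_s s_notin_q; apply/existsP => -[i]; rewrite inE; by rewrite stE.
- by rewrite mem_pre_q !inE (mem_imset _ _ q_inj) inE stE eqxx andbT.
- by rewrite mem_pre_f f_notin_q.
Qed.

(** No transition enters [s], so sets with and without [s] have the same predecessors; the flag [b]
    treats both. As [s] reaches all of $Q_n$ by every letter, a nonempty [X] always brings [s]
    in. *)
Lemma pre_q_s (b : bool) X a : X != set0 ->
  pre (if b then sq X else q @: X) a = sq (tau a @: X).
Proof.
case/set0Pn=> j Xj; apply/setP=> p; set P := (if b then _ else _).
have Pq i : (q i \in P) = (i \in X).
  by rewrite /P; case: b {P}; rewrite ?mem_sq ?stE (mem_imset _ _ q_inj).
have Pf : (f \in P) = false.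
  by rewrite /P; case: b {P Pq}; rewrite ?mem_sq ?stE f_notin_q.
case: (stateP p) => [|i|].
- by rewrite mem_pre_s mem_sq eqxx; apply/existsP; exists j; rewrite Pq.
- by rewrite mem_pre_q Pq Pf andbF orbF mem_sq stE (mem_imset _ _ q_inj) mem_tau.
- by rewrite mem_pre_f mem_sq !stE f_notin_q.
Qed.

Lemma card_lower (k : nat) : k <= n -> #|[set i : 'I_n | i < k]| = k.
Proof.
move=> le_kn; rewrite -sum1dep_card -(big_mkord (fun x => x < k) (fun=> 1)).
by rewrite -(big_nat_widen 0 k n xpredT) // sum_nat_const_nat subn0 muln1.
Qed.

Lemma card_upper a : #|upper a| = n - a.
Proof.
have -> : upper a = ~: [set i : 'I_n | i < a].
  by apply/setP=> i; rewrite !inE -leqNgt.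
by rewrite cardsCs setCK card_lower ?card_ord // ltnW.
Qed.

Lemma tau_id : tau ord0 =1 id.
Proof. by move=> i; rewrite /tau tperm1 perm1. Qed.

(** Letters read backwards act on [X] by star transpositions, hence words act by all permutations,
    and these are transitive on sets of a given size. *)
Lemma sq_reachable (b : bool) X Y : X != set0 -> #|X| = #|Y| ->
  (if b then sq X else q @: X) \in AR_new n -> sq Y \in AR_new n.
Proof.
move=> X0 /exists_perm_imset [t <-] {Y}; move: t b X X0; apply: star_tperm_ind.
(* Even the identity reads one letter: $a_1$ fixes [X] and adds [s] if it was missing. *)
- move=> b X X0 /(subset_states_step ord0); rewrite pre_q_s //.
  by rewrite (eq_imset _ tau_id) imset_id (eq_imset _ (@perm1 _)) imset_id.
- move=> a t IHt b X X0 /(subset_states_step a); rewrite pre_q_s // => AR.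
  have -> : (tperm ord0 a * t)%g @: X = t @: (tau a @: X).
    by rewrite -imset_comp; apply: eq_imset => i; rewrite permM.
  by apply: (IHt true) AR; rewrite -card_gt0 card_imset ?card_gt0 //; apply: perm_inj.
Qed.

Lemma AR_newE : AR_new n =
  [set f] |: ([set q @: upper a | a : 'I_n] :|: sq @: [set~ set0]).
Proof.
apply/setP=> P; apply/idP/idP => [|].
- move: P; apply: subset_states_ind => [|P a]; first by rewrite setU11.
  have sqK X b : X != set0 -> pre (if b then sq X else q @: X) a \in sq @: [set~ set0].
    move=> X0; rewrite pre_q_s // imset_f // !inE.
    by rewrite -card_gt0 card_imset ?card_gt0 //; apply: perm_inj.
  rewrite !in_setU1 !in_setU => /or3P [/eqP -> | /imsetP [b _ ->] | /imsetP [X X0 ->]].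
  + by rewrite pre_final imset_f ?orbT.
  + rewrite (sqK _ false) ?orbT //; apply/set0Pn; exists b.
    by rewrite inE.
  + by rewrite (sqK _ true) ?orbT //; rewrite !inE in X0.
- have f_in : [set f] \in AR_new n by apply: subset_states_init.
  have up_in a : q @: upper a \in AR_new n by rewrite -pre_final subset_states_step.
  rewrite !in_setU1 !in_setU => /or3P [/eqP -> // | /imsetP [b _ ->] // | /imsetP [X X0 ->]].
  have {}X0 : 0 < #|X| by rewrite card_gt0; rewrite !inE in X0.
  have Xn : #|X| <= n by rewrite -[n in _ <= n]card_ord max_card.
  (* The upper set starting at [n - #|X|] has as many elements as [X], so a permutation carries it
     to [X]. *)
  have a_lt : n - #|X| < n by rewrite ltn_subrL X0.
  have card_up : #|upper (Ordinal a_lt)| = #|X| by rewrite card_upper subKn.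
  apply: (sq_reachable (b := false) _ card_up (up_in _)).
  by rewrite -card_gt0 card_up.
Qed.

Lemma sq_inj : injective sq.
Proof.
move=> X Y eqXY; apply/setP=> i; have /setP/(_ (q i)) := eqXY.
by rewrite !mem_sq !(mem_imset _ _ q_inj) stE.
Qed.

(** The three families are disjoint, separated by [f] and by [s], and have sizes $1$, $n$ and
    $2^n-1$. *)
Lemma card_AR_new : #|AR_new n| = 2 ^ n + n.
Proof.
rewrite AR_newE cardsU1 cardsU (card_imset _ sq_inj) card_in_imset; last first.
  move=> a b _ _ /(imset_inj q_inj) /setP eqab; apply: val_inj; apply/eqP.
  rewrite eqn_leq -[a <= b]/(nat_of_ord a <= b).
  by have := eqab a; have := eqab b; rewrite !inE !leqnn => -> <-.
have -> : [set q @: upper a | a : 'I_n] :&: sq @: [set~ set0] = set0.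
  apply/setP=> P; rewrite !inE; apply/andP => -[/imsetP [a _ ->] /imsetP [X _ /setP/(_ s)]].
  by rewrite s_notin_q mem_sq eqxx.
have -> : [set f] \in [set q @: upper a | a : 'I_n] :|: sq @: [set~ set0] = false.
  rewrite !inE; apply/orP => -[] /imsetP [x _ /setP/(_ f)].
    by rewrite f_notin_q inE eqxx.
  by rewrite mem_sq f_notin_q !stE inE eqxx.
rewrite cards0 subn0 cardsC1 card_ord -cardsT -powersetT card_powerset cardsT card_ord.
by rewrite addnCA [RHS]addnC add1n prednK ?expn_gt0.
Qed.

(** * Forward subset construction of the original transducer *)

Local Notation Qn := (q @: [set: 'I_n]).

Lemma post_s a : dstep trans [set s] a = Qn.
Proof.
apply/setP=> p; rewrite mem_dstep; apply/exists_inP/imsetP => [[r] | [i _ ->]].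
  by rewrite in_set1 => /eqP ->; rewrite trans_s => /existsP [i /eqP ->]; exists i.
by exists s; rewrite ?in_set1 // trans_s; apply/existsP; exists i.
Qed.

(** Every letter permutes $Q_n$ and leads from $q_n$ to [f], while nothing leaves [f]; so the set
    stabilizes. *)
Lemma post_Qn (b : bool) a : dstep trans (if b then f |: Qn else Qn) a = f |: Qn.
Proof.
have inP i : q i \in (if b then f |: Qn else Qn) by case: b; rewrite ?in_setU1 imset_f ?orbT.
apply/setP=> p; rewrite mem_dstep in_setU1; apply/exists_inP/orP => [[r] | [/eqP -> |]].
- have : (r == f) || (r \in Qn) -> trans r a p -> p == f \/ p \in Qn.
    case/orP=> [/eqP -> | /imsetP [i _ ->]]; first by rewrite trans_f.
    by rewrite trans_q => /orP [/eqP -> | /andP [_]]; [right; rewrite imset_f | left].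
  by case: b {inP} => Pr Pr'; apply: Pr; rewrite -in_setU1 // in_setU1 Pr' orbT.
- by exists (q ord_max); rewrite ?inP // trans_q -ltnS ltn_ord eqxx orbT.
- case/imsetP=> i _ ->; exists (q (tau a i)); first exact: inP.
  by rewrite trans_q tauK eqxx.
Qed.

Lemma AL_newE : AL_new n = [set [set s]; Qn; f |: Qn].
Proof.
apply/setP=> P; apply/idP/idP => [|].
- move: P; apply: subset_states_ind => [|P a]; first by rewrite !inE eqxx.
  rewrite !inE -orbA => /or3P [] /eqP ->; first by rewrite post_s eqxx !orbT.
    by rewrite (post_Qn false) eqxx !orbT.
  by rewrite (post_Qn true) eqxx !orbT.
- have s_in : [set s] \in AL_new n by apply: subset_states_init.
  have Q_in : Qn \in AL_new n by rewrite -(post_s ord0) subset_states_step.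
  case/setUP=> [/set2P [] -> // | /set1P ->].
  by rewrite -(post_Qn false ord0) subset_states_step.
Qed.

Lemma card_AL_new : #|AL_new n| = 3.
Proof.
rewrite AL_newE setUC cardsU1 cards2 !inE.
have neq (P P' : {set St}) p : (p \in P) != (p \in P') -> (P == P') = false.
  by apply: contraNF => /eqP ->.
rewrite (neq (f |: Qn) [set s] f) ?(neq (f |: Qn) Qn f) ?(neq [set s] Qn s) //.
- by rewrite in_set1 eqxx s_notin_q.
- by rewrite setU11 f_notin_q.
- by rewrite setU11 in_set1 !stE.
Qed.

(** * Specialized determinization of this transducer *)

Local Notation generated := (sd_generated s delta).
Local Notation newN := (sd_newN delta).

Lemma trans_to_s p a : trans p a s = false.
Proof.
case: (stateP p) => [|i|]; rewrite ?trans_q ?trans_f ?stE ?andbF //.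
by rewrite trans_s; apply/existsP => -[i]; rewrite !stE.
Qed.

Lemma newN_s p N a v : s \notin newN p N a v.
Proof.
apply/sd_newNP => -[[p' _] | [v' _ d_in]]; first by rewrite trans_to_s.
by have : trans p a s by [apply/under_transP; exists v']; rewrite trans_to_s.
Qed.

Lemma generated_s x : generated x -> s \notin x.2 /\ (x.1 = s -> x = sd_init s).
Proof.
move: x; apply: (sd_generated_ind (K := fun x => s \notin x.2 /\ (x.1 = s -> x = sd_init s))).
  by rewrite inE.
case=> p N a y _ /sd_stepP [v [r [d_in -> _]]] /=; split=> [|rs]; first exact: newN_s.
by have : trans p a r by [apply/under_transP; exists v]; rewrite rs trans_to_s.
Qed.

(** Within $Q_n$ the second component is merely transported by [tau a]: a cheaper competitor from
    [q i] could only go to [f]. The premise on [s] matters because [s] would lead to every state of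
    $Q_n$. *)
Lemma mem_newN_q i N a k :
  s \notin N -> (q k \in newN (q i) N a (outQ i a)) = (q (tau a k) \in N).
Proof.
move=> sN; apply/sd_newNP/idP => [[[p] | [v lt_v d_in]] | Nk].
- case: (stateP p) => [|j|]; rewrite ?(negPf sN) ?trans_q ?trans_f //.
  by move=> Nj; rewrite !stE andbF orbF => /eqP ->; rewrite tauK.
- have : trans (q i) a (q k) by apply/under_transP; exists v.
  rewrite trans_q !stE andbF orbF => /eqP ek.
  have d_in' : (q i, a, outQ i a, q k) \in delta by rewrite ek; apply/mem_Tdelta; constructor.
  by rewrite (Tdelta_out_uniq d_in d_in') ltnn in lt_v.
- by left; exists (q (tau a k)); rewrite // trans_q tauK eqxx.
Qed.

(** Outputs from [s] increase with the target index, so the competitors beating [q i] are the states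
    of smaller index. *)
Lemma step_s a y :
  sd_step delta (sd_init s) a y <-> exists i, y = (q i, q @: [set k : 'I_n | k < i]).
Proof.
have newNE i : newN s set0 a i = q @: [set k : 'I_n | k < i].
  apply/setP=> p; apply/sd_newNP/imsetP => [[[p'] | [v lt_v]] | [k]]; first by rewrite inE.
    move/mem_Tdelta; case E: _ / => [j b|j b|j b _]; case: E => /eqP; rewrite ?stE // => _ ev ->.
    by exists j; rewrite // inE -ev.
  rewrite inE => lt_ki ->; right; exists k => //.
  by apply/mem_Tdelta; constructor.
have newN_i i : q i \notin newN s set0 a i by rewrite newNE (mem_imset _ _ q_inj) inE ltnn.
split=> [/sd_stepP [v [r [/mem_Tdelta d_in -> _]]] | [i ->]].
  case E: _ / d_in => [j b|j b|j b _]; case: E => /eqP; rewrite ?stE // => _ -> ->.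
  by exists j; rewrite newNE.
apply/sd_stepP; exists (nat_of_ord i), (q i); rewrite newNE; split=> //; last by rewrite -newNE.
by apply/mem_Tdelta; constructor.
Qed.

(** The target lies in the new second component only if [q i] lies in [N], which no generated pair
    allows. *)
Lemma step_q i N a : generated (q i, N) ->
  sd_step delta (q i, N) a (q (tau a i), newN (q i) N a (outQ i a)).
Proof.
move=> gen; have [sN _] := generated_s gen; apply/sd_stepP.
exists (outQ i a), (q (tau a i)); split=> //; first by apply/mem_Tdelta; constructor.
by rewrite mem_newN_q // tauK; apply: sd_generated_notin gen.
Qed.

(** One letter reaches $q_1$ by its cheapest transition, so nothing beats it; the letter [i] then
    swaps $q_1$ with [q i]. *)
Lemma generated_q0 i : generated (q i, set0).
Proof.
have gen0 : generated (q ord0, set0).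
  apply: (sd_generated_step (sd_generated_init _ _) (a := ord0)).
  apply/step_s; exists ord0; congr pair; apply/esym/eqP.
  by rewrite imset_eq0; apply/eqP/setP=> k; rewrite !inE.
have [-> // | i0] := eqVneq i ord0.
apply: (sd_generated_step gen0 (a := i)).
suff -> : (q i, set0) = (q (tau i ord0), newN (q ord0) set0 i (outQ ord0 i)) by apply: step_q.
congr pair; first by rewrite /tau tpermL.
apply/setP=> p; case: (stateP p) => [|k|].
- by rewrite inE (negPf (newN_s _ _ _ _)).
- by rewrite mem_newN_q !inE.
rewrite inE; apply/esym/sd_newNP => -[[p'] | [v _ d_in]]; first by rewrite inE.
have : trans (q ord0) i f by apply/under_transP; exists v.
(* From $q_1$ only $a_1$ leads to [f], and [i] is not [ord0] here. *)
by rewrite trans_q eqxx andbT leqn0 !stE; apply/negP.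
Qed.

(** Supplies a generated pair with first component [f], needed both to recover [[set f]] from its
    survivors and to separate the sets reached by $a_1$ and by $a_1a_1$. *)
Lemma step_f : exists N, sd_step delta (q ord0, set0) ord0 (f, N).
Proof.
have d_in : (q ord0, ord0, 2 * n - 1 + 1, f) \in delta by apply/mem_Tdelta; constructor.
exists (newN (q ord0) set0 ord0 (2 * n - 1 + 1)).
apply/sd_stepP; exists (2 * n - 1 + 1), f; split=> //.
apply/sd_newNP => -[[p'] | [v lt_v d_in']]; first by rewrite inE.
by rewrite (Tdelta_out_uniq d_in d_in') ltnn in lt_v.
Qed.

(** * The reversed determinization of the trimmed transducer *)

Lemma survivors_inj : {in AR_new n &, injective (survivors s delta)}.
Proof.
(* A reachable [P] is recovered as the set of first components of its survivors. *)
have wit P p : P \in AR_new n -> p \in P = [exists N, (p, N) \in survivors s delta P].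
  move=> ARP; apply/idP/existsP => [Pp | [N]]; last by rewrite inE => /and3P [].
  case: (stateP p) Pp => [|i|] Pp.
  - by exists set0; rewrite inE Pp sd_generated_init /= -setI_eq0 set0I eqxx.
  - by exists set0; rewrite inE Pp generated_q0 /= -setI_eq0 set0I eqxx.
  (* Among the reachable sets only [[set f]] contains [f], so there it suffices that [N] avoids
     [f]. *)
  have Pf : P = [set f].
    move: ARP Pp; rewrite AR_newE in_setU1 in_setU.
    case/or3P=> [/eqP // | /imsetP [a _ ->] | /imsetP [X _ ->]].
      by rewrite f_notin_q.
    by rewrite mem_sq f_notin_q !stE.
  have [N fN] := step_f; exists N.
  have gN := sd_generated_step (generated_q0 _) fN.
  by rewrite inE gN Pf in_set1 eqxx disjoint_sym disjoints1 (sd_generated_notin gN).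
by move=> P P' ARP ARP' eqP; apply/setP=> p; rewrite !wit // eqP.
Qed.

Lemma card_AR_std : 2 ^ n + n <= #|AR_std n|.
Proof.
rewrite -card_AR_new -(card_in_imset survivors_inj) subset_leq_card //.
by apply/subsetP=> _ /imsetP [P ARP ->]; apply: survivors_subset_states.
Qed.

(** Trimming removes nothing. In a generated pair [N] contains neither [s] nor the first component,
    so the pair survives for $\{s,q_1\}$, $\{s,q_i\}$ or $\{f\}$ according to its first
    component. *)
Lemma generated_kept x : generated x -> sd_kept s (Tfinal n) delta x.
Proof.
move=> gx; rewrite /sd_kept gx /=.
suff [P ARP xP] : exists2 P, P \in AR_new n & x \in survivors s delta P.
  exact: survivors_coacc xP.
have sq_in i : sq [set i] \in AR_new n.
  rewrite AR_newE; apply/setUP; right; apply/setUP; right; apply: imset_f.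
  by rewrite !inE -card_gt0 cards1.
have [sN s_init] := generated_s gx; have xN := sd_generated_notin gx.
case: x => p N in gx sN s_init xN *; case: (stateP p) => [|i|] in gx s_init xN *.
- exists (sq [set ord0]); rewrite ?sq_in // inE gx mem_sq eqxx.
  by case: (s_init erefl) => ->; rewrite -setI_eq0 set0I eqxx.
- exists (sq [set i]); rewrite ?sq_in // inE gx mem_sq (mem_imset _ _ q_inj) in_set1 eqxx orbT.
  apply/pred0P => r /=; apply/negP => /andP [+ rP].
  by move: rP; rewrite mem_sq imset_set1 in_set1 => /orP [] /eqP ->; apply/negP.
- exists [set f]; first exact: subset_states_init.
  by rewrite inE gx in_set1 eqxx disjoint_sym disjoints1.
Qed.

(** * The forward determinization of the trimmed transducer: ranks and permutations *)

Local Notation ttrans := (trim_trans s (Tfinal n) delta).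

Lemma trim_transE x a y : ttrans x a y = generated x && sd_step delta x a y.
Proof.
rewrite /trim_trans /sd_trans; case: (boolP (generated x)) => [gx|]; last by rewrite !andbF.
case: (boolP (sd_step _ _ _ _)) => [xy|]; last by rewrite !andbF.
by rewrite !generated_kept //; apply: sd_generated_step xy.
Qed.

(** Excluding [s] as a first component forces each pair over $Q_n$ in the next set to come from a
    pair over $Q_n$. *)
Definition ranked (t : 'S_n) (S : {set St * {set St}}) :=
  [/\ {in S, forall x, generated x /\ x.1 != s},
      forall i, exists N, (q i, N) \in S
    & forall i N, (q i, N) \in S -> #|[set k | q k \in N]| = t i].

(** A pair over [q i] comes from one over [q (tau a i)], and [tau a] maps the indices in one second
    component bijectively onto those in the other, so the count is preserved. *)
Lemma ranked_step t S a : ranked t S -> ranked (tperm ord0 a * t)%g (dstep ttrans S a).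
Proof.
case=> genS exS rkS; split=> [y | i | i N].
- rewrite mem_dstep => /exists_inP [[p N] Sx]; rewrite trim_transE => /andP [gx xy].
  split; first exact: sd_generated_step xy.
  case/sd_stepP: xy => v [r [d_in -> _]] /=; apply/eqP => rs.
  by have : trans p a r by [apply/under_transP; exists v]; rewrite rs trans_to_s.
- have [N SN] := exS (tau a i); have [gN _] := genS _ SN.
  exists (newN (q (tau a i)) N a (outQ (tau a i) a)); rewrite mem_dstep; apply/exists_inP.
  exists (q (tau a i), N) => //; rewrite trim_transE gN /=.
  by have := step_q a gN; rewrite tauK.
- rewrite mem_dstep => /exists_inP [[p N'] Sx]; rewrite trim_transE => /andP [gx].
  case/sd_stepP => v [r [d_in [er ->] _]]; rewrite -{r}er in d_in.
  have [_ ps] := genS _ Sx; have [sN _] := generated_s gx.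
  have : trans p a (q i) by apply/under_transP; exists v.
  case: (stateP p) => [|j|] in gx d_in ps Sx *; rewrite ?trans_f //; first by rewrite eqxx in ps.
  rewrite trans_q !stE andbF orbF => /eqP ei.
  have d_in' : (q j, a, outQ j a, q i) \in delta by rewrite ei; apply/mem_Tdelta; constructor.
  rewrite (Tdelta_out_uniq d_in d_in') permM ei tpermK -(rkS _ _ Sx).
  rewrite -[RHS](card_imset _ (@perm_inj _ (tperm ord0 a))); apply: eq_card => k.
  by rewrite mem_tau in_set [RHS]in_set mem_newN_q // tauK.
Qed.

Lemma ranked_uniq t t' S : ranked t S -> ranked t' S -> t = t'.
Proof.
case=> _ exS rk [_ _ rk']; apply/permP => i; apply: val_inj.
by have [N SN] := exS i; rewrite /= -(rk _ _ SN) -(rk' _ _ SN).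
Qed.

Lemma card_AL_std : n`! + 2 <= #|AL_std n|.
Proof.
pose R0 : {set St * {set St}} := [set sd_init s]; pose R1 := dstep ttrans R0 ord0.
have R0_in : R0 \in AL_std n.
  suff -> : R0 = trim_init s (Tfinal n) delta by apply: subset_states_init.
  apply/setP=> x; rewrite !inE; case: eqP => [-> | _]; last by rewrite andbF.
  by rewrite generated_kept ?sd_generated_init.
have R1_in : R1 \in AL_std n by apply: subset_states_step.
have R1P y : reflect (exists i, y = (q i, q @: [set k : 'I_n | k < i])) (y \in R1).
  rewrite mem_dstep; apply: (iffP exists_inP) => [[x] | [i ->]].
    by rewrite in_set1 => /eqP ->; rewrite trim_transE => /andP [_ /step_s].
  exists (sd_init s); first by rewrite in_set1.
  by rewrite trim_transE sd_generated_init; apply/step_s; exists i.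
have R1_ranked : ranked 1%g R1.
  split=> [y R1y | i | i N /R1P [j [/q_inj <- ->]]].
  - split; last by case/R1P: R1y => i -> /=; rewrite stE.
    move: R1y; rewrite mem_dstep => /exists_inP [x _].
    by rewrite trim_transE => /andP [gx]; apply: sd_generated_step.
  - by exists (q @: [set k : 'I_n | k < i]); apply/R1P; exists i.
  - rewrite perm1 -[RHS](card_lower (ltnW (ltn_ord i))); apply: eq_card => k.
    by rewrite inE (mem_imset _ _ q_inj).
have R0_unranked t : ~ ranked t R0.
  by case=> _ /(_ ord0) [N]; rewrite in_set1 => /eqP [/eqP]; rewrite stE.
(* Avoiding [R1] for every [t], the identity included, lets [R1] be counted on top of the $n!$
   sets. *)
have exR t : exists S, [/\ S \in AL_std n, ranked t S & S != R1].
  have [S [S_in S_t]] : exists S, S \in AL_std n /\ ranked t S.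
    elim/star_tperm_ind: t => [|a t [S [S_in S_t]]]; first by exists R1.
    by exists (dstep ttrans S a); split; [apply: subset_states_step | apply: ranked_step].
  have [eqS | neS] := eqVneq S R1; last by exists S.
  have -> : t = 1%g by apply: ranked_uniq R1_ranked; rewrite -eqS.
  exists (dstep ttrans R1 ord0); split; first exact: subset_states_step.
    by have := ranked_step ord0 R1_ranked; rewrite tperm1 mulg1.
  have [N fN] := step_f; apply/eqP => /setP/(_ (f, N)).
  have -> : (f, N) \in R1 = false by apply/R1P => -[i [/eqP]]; rewrite !stE.
  move/negbT; rewrite mem_dstep => /exists_inP []; exists (q ord0, set0).
    apply/R1P; exists ord0; congr pair; apply/esym/eqP.
    by rewrite imset_eq0; apply/eqP/setP=> k; rewrite !inE.
  by rewrite trim_transE generated_q0.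
(* Choose one such set for each permutation; the permutation can be read off from the set, so the
   choice is injective. *)
have [g gP] := fin_all_exists exR.
have g_inj : injective g.
  by move=> t t' eqg; have [_ gt _] := gP t; have [_ + _] := gP t'; rewrite -eqg; apply: ranked_uniq.
have <- : #|R0 |: (R1 |: g @: setT)| = n`! + 2.
  rewrite !cardsU1 card_imset // cardsT card_Sn !in_setU1.
  have -> : R1 \in g @: setT = false.
    by apply/imsetP => -[t _ eqR]; have [_ _ /eqP] := gP t; rewrite eqR.
  have -> : R0 == R1 = false by apply/eqP => eqR; apply: (R0_unranked 1%g); rewrite eqR.
  have -> : R0 \in g @: setT = false.
    by apply/imsetP => -[t _ eqR]; have [_ + _] := gP t; rewrite -eqR; apply: R0_unranked.
  by rewrite addnA addnC.
apply: subset_leq_card; rewrite !subUset !sub1set R0_in R1_in /=.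
by apply/subsetP => _ /imsetP [t _ ->]; have [] := gP t.
Qed.

End Transducer.

Theorem theorem5 (n : nat) : 0 < n ->
  (n`! + 2) + (2 ^ n + n) <= #|AL_std n| + #|AR_std n|
  /\ #|AL_new n| + #|AR_new n| = 3 + (2 ^ n + n).
Proof.
case: n => // m _; split; last by rewrite card_AL_new card_AR_new.
by apply: leq_add; [apply: card_AL_std | apply: card_AR_std].
Qed.
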